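(* Let $\mu$ be a radial weight. Then $H^\infty\neq \mathcal{B}^\mu$.
   Context: $\mathbb{D}=\{z\in\mathbb{C}:|z|<1\}$ and $\mathcal{H}(\mathbb{D})$ is the space of analytic functions in $\mathbb{D}$. A radial weight is a nonnegative function $\mu\in L^1([0,1))$, extended to $\mathbb{D}$ by $\mu(z)=\mu(|z|)$. Put $\widehat{\mu}(z)=\int_{|z|}^1\mu(s)\,ds$; it is assumed throughout that $\widehat{\mu}(z)>0$ for all $z\in\mathbb{D}$. For $x\ge 0$ let $\mu_x=\int_0^1 r^x\mu(r)\,dr$. For $f(z)=\sum_{n=0}^\infty \widehat{f}(n)z^n\in\mathcal{H}(\mathbb{D})$ the fractional derivative induced by $\mu$ is $$D^\mu(f)(z)=\sum_{n=0}^\infty\frac{\widehat{f}(n)}{\mu_{2n+1}}z^n,\quad z\in\mathbb{D},$$ which belongs to $\mathcal{H}(\mathbb{D})$. Define $$\mathcal{B}^\mu=\Big\{f\in\mathcal{H}(\mathbb{D}):\|f\|_{\mathcal{B}^\mu}=\sup_{z\in\mathbb{D}}\widehat{\mu}(z)|D^\mu(f)(z)|<\infty\Big\}.$$ $H^\infty$ is the space of bounded analytic functions in $\mathbb{D}$. *)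

(* Defs.v *)
From HB Require Import structures.
From mathcomp Require Import all_boot all_order all_algebra.
From mathcomp Require Export complex.
From mathcomp Require Import all_classical all_reals all_analysis.

Set Implicit Arguments.
Unset Strict Implicit.
Unset Printing Implicit Defensive.

Import Order.TTheory GRing.Theory Num.Theory ComplexField.
Import numFieldNormedType.Exports.

Local Open Scope classical_set_scope.
Local Open Scope ring_scope.
Local Open Scope complex_scope.

(* The norm `|z| of z : R[i] lies in R[i]; [cmod z] is the same number seen
   in R. *)
Definition cmod (R : realType) (z : R[i]) : R := Normc.normc z.

Definition unit_disc (R : realType) : set R[i] := [set z | cmod z < 1].

(* Analytic functions in the unit disc are represented by total functions on
   R[i] whose values outside the disc are irrelevant: membership in every space
   below depends only on the restriction of the function to the disc.
   Derivatives are complex ones: R[i]^o is R[i] as a normed module over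
   itself. *)
Definition analytic_in_disc (R : realType) : set (R[i] -> R[i]) :=
  [set f | forall z, unit_disc z ->
     derivable (f : R[i]^o -> R[i]^o) z 1].

Definition taylor_coef (R : realType) (f : R[i] -> R[i]) (n : nat) : R[i] :=
  ((f : R[i] -> R[i]^o)^`(n))%classic 0 / n`!%:R.

(* Only the values on [0, 1[ matter; the radial extension of mu to the disc is
   z |-> mu (cmod z). *)
Definition radial_weight (R : realType) (mu : R -> R) : Prop :=
  (forall r, 0 <= r < 1 -> 0 <= mu r) /\
  (@lebesgue_measure R).-integrable `[0, 1[ (EFin \o mu).

Definition weight_tail (R : realType) (mu : R -> R) (z : R[i]) : R :=
  Rintegral (@lebesgue_measure R) `[cmod z, 1[ mu.

Definition weight_moment (R : realType) (mu : R -> R) (x : R) : R :=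
  Rintegral (@lebesgue_measure R) `[0, 1[ (fun r => r `^ x * mu r).

(* [limn] is total; for f analytic in the disc, z in the disc and mu a radial
   weight with positive tail the series does converge. *)
Definition frac_derivative (R : realType) (mu : R -> R) (f : R[i] -> R[i])
    (z : R[i]) : R[i] :=
  limn (series (fun n : nat =>
    taylor_coef f n / (weight_moment mu (2 * n + 1)%N%:R)%:C * z ^+ n)
    : nat -> R[i]^o).

(* Extended-real-valued, so that an unbounded weighted derivative gets norm +oo. *)
Definition bloch_norm (R : realType) (mu : R -> R) (f : R[i] -> R[i]) : \bar R :=
  ereal_sup [set (weight_tail mu z * cmod (frac_derivative mu f z))%:E
            | z in @unit_disc R].

Definition bloch_space (R : realType) (mu : R -> R) : set (R[i] -> R[i]) :=
  [set f | analytic_in_disc f /\ (bloch_norm mu f < +oo)%E].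

Definition hardy_infty (R : realType) : set (R[i] -> R[i]) :=
  [set f | analytic_in_disc f /\
     exists M : R, forall z, unit_disc z -> cmod (f z) <= M].

Arguments hardy_infty R : clear implicits.

(* Main.v *)
(* Let T be the tail integral of mu, m_n = mu_(2n+1), and
   G_n(r) = T(r) r^n / m_n, so that the monomial z^n has Bloch norm sup_r G_n(r).
   If the G_n are not uniformly bounded, choose n_k with sup G_(n_k) >= 4^k:
   the function f = sum_k 2^-k z^(n_k) is bounded, while all coefficients of
   its fractional derivative are nonnegative, so the Bloch norm of f is at
   least 2^-k 4^k for every k.
   If G_n <= C for all n, then G_n(r) -> 0 both as r -> 1 (n fixed) and as
   n -> oo (uniformly on [0, rho], rho < 1), so a gliding hump yields n_k with
   sum_k G_(n_k) <= C + 2: the unbounded function f = sum_k z^(n_k) belongs to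
   the Bloch-type space. *)
Require Import Defs.
From mathcomp Require Import all_boot all_order all_algebra.
From mathcomp Require Import all_classical all_reals all_analysis.
From mathcomp Require Import measurable_realfun ring lra.

Set Implicit Arguments.
Unset Strict Implicit.
Unset Printing Implicit Defensive.

Import Order.TTheory GRing.Theory Num.Theory ComplexField.
Import numFieldNormedType.Exports.

Local Open Scope classical_set_scope.
Local Open Scope ring_scope.
Local Open Scope complex_scope.

(** * Power series in the complex unit disc *)

Lemma is_derive_eps (K : numFieldType) (f : K^o -> K^o) (z l : K) :
  (forall e, 0 < e -> exists2 d, 0 < d & forall h, h != 0 -> `|h| < d ->
     `|h^-1 * (f (z + h) - f z) - l| <= e) ->
  is_derive (z : K^o) (1 : K^o) f l.
Proof.
move=> H.
have c : h^-1 *: ((f \o shift z) (h *: (1 : K^o)) - f z) @[h --> (0 : K)^']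
    --> (l : K^o).
  apply/cvgrPdist_le => e /H[d d0 hd]; apply/nbhs_ballP; exists d => // h.
  rewrite /ball /= sub0r normrN => hd' h0.
  by rewrite distrC [h *: 1]mulr1 /= [h + z]addrC; exact: (hd h h0 hd').
by split; [exact: cvgP c|exact: (cvg_lim (@norm_hausdorff _ K^o) c)].
Qed.

Section ComplexSeries.
Variable R : realType.
Implicit Types (a : nat -> R[i]) (z w : R[i]) (r : R).

(** * The real-valued modulus and convergence in [R[i]] *)

Lemma normE z : `|z| = (cmod z)%:C. Proof. by []. Qed.

Lemma cmod_ge0 z : 0 <= cmod z.
Proof. by rewrite -ler0c -normE normr_ge0. Qed.

Lemma cmodM z w : cmod (z * w) = cmod z * cmod w.
Proof. exact: Normc.normcM. Qed.

Lemma cmodX z n : cmod (z ^+ n) = cmod z ^+ n.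
Proof. by apply: complexI; rewrite -normE normrX normE rmorphXn. Qed.

Lemma cmod0 : cmod (0 : R[i]) = 0.
Proof. by apply: complexI; rewrite -normE normr0. Qed.

Lemma cmodD z w : cmod (z + w) <= cmod z + cmod w.
Proof. exact: le_normcD. Qed.

Lemma cmodN z : cmod (- z) = cmod z.
Proof. exact: normcN. Qed.

Lemma cmodR r : cmod r%:C = `|r|.
Proof. by rewrite /cmod /Normc.normc /= expr0n addr0 sqrtr_sqr. Qed.

Lemma cmod_eq0 z : cmod z = 0 -> z = 0.
Proof. exact: Normc.eq0_normc. Qed.

Lemma cmod_sum n a : cmod (\sum_(0 <= i < n) a i) <= \sum_(0 <= i < n) cmod (a i).
Proof.
elim: n => [|n IH]; first by rewrite !big_nil cmod0.
by rewrite !big_nat_recr //=; apply: (le_trans (cmodD _ _)); rewrite lerD2r.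
Qed.

(** Real tolerances suffice: in the partial order of [R[i]], [0 < e] forces the imaginary part of
    [e] to vanish. *)
Lemma cvg_cmodP {T} (F : set_system T) {FF : Filter F} (f : T -> R[i]^o) (l : R[i]) :
  f x @[x --> F] --> (l : R[i]^o) <->
  forall e : R, 0 < e -> \forall x \near F, cmod (f x - l) <= e.
Proof.
split=> [/cvgrPdist_le fl e e0|fl].
  have := fl e%:C; rewrite ltcR => /(_ e0); apply: filterS => x.
  by rewrite -lecR -normE distrC.
apply/cvgrPdist_le => e; rewrite ltcE => /= /andP[/eqP eIm eRe].
have {eIm}-> : e = (complex.Re e)%:C by case: e eIm eRe => ? ? /= ->.
by apply: filterS (fl _ eRe) => x; rewrite distrC -lecR -normE.
Qed.

(** Closed discs are closed; this carries bounds on partial sums over to sums of series. *)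
Lemma cvg_cmod_le {T} (F : set_system T) {FF : ProperFilter F}
    (f : T -> R[i]^o) (l : R[i]) (K : R) :
  f x @[x --> F] --> (l : R[i]^o) -> (\forall x \near F, cmod (f x) <= K) ->
  cmod l <= K.
Proof.
move=> /cvg_cmodP fl fK; apply/ler_addgt0Pr => e e0.
have [x [/= h1 h2]] := filter_ex (filterI (fl _ e0) fK).
have -> : l = f x - (f x - l) by rewrite opprB addrC subrK.
by apply: (le_trans (cmodD _ _)); rewrite cmodN lerD.
Qed.

Lemma cmod_le_ReIm (x y : R) : cmod (x +i* y) <= `|x| + `|y|.
Proof.
have -> : x +i* y = x%:C + 0 +i* y by simpc.
by apply: (le_trans (cmodD _ _)); rewrite cmodR lerD2l /cmod
  /Normc.normc /= expr0n add0r sqrtr_sqr.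
Qed.

Lemma Re_le_cmod z : `|complex.Re z| <= cmod z.
Proof. by rewrite -lecR -normE normc_ge_Re. Qed.

Lemma Im_le_cmod z : `|complex.Im z| <= cmod z.
Proof.
case: z => x y /=; rewrite -(sqrtr_sqr y) /cmod /Normc.normc ler_wsqrtr //.
by rewrite lerDr sqr_ge0.
Qed.

(** The real and imaginary parts are dominated by the modulus, so both converge absolutely in [R];
    their limits are reassembled into a complex one. *)
Lemma abs_cvg_series (u : nat -> R[i]^o) :
  cvgn (series (fun n => cmod (u n))) -> cvgn (series u).
Proof.
move=> cu.
have cRe : cvgn (series (fun n => complex.Re (u n))).
  apply: normed_cvg; apply: (series_le_cvg _ _ _ cu) => n; rewrite ?cmod_ge0 //=.
  exact: Re_le_cmod.
have cIm : cvgn (series (fun n => complex.Im (u n))).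
  apply: normed_cvg; apply: (series_le_cvg _ _ _ cu) => n; rewrite ?cmod_ge0 //=.
  exact: Im_le_cmod.
pose l := limn (series (fun n => complex.Re (u n))) +i*
  limn (series (fun n => complex.Im (u n))).
apply/cvg_ex; exists l.
apply/cvg_cmodP => e e0.
have e2 : 0 < e / 2 by rewrite divr_gt0.
move/cvgrPdist_le : cRe => /(_ _ e2) cRe.
move/cvgrPdist_le : cIm => /(_ _ e2) cIm.
apply: filterS2 cRe cIm => n hR hI.
suff : cmod (series u n - l) <= e by [].
have -> : series u n =
    series (fun n => complex.Re (u n)) n +i* series (fun n => complex.Im (u n)) n.
  rewrite /series /=; elim: n {hR hI} => [|n IH]; first by rewrite !big_nil.
  by rewrite !big_nat_recr //= IH; case: (u n).
apply: (le_trans (cmod_le_ReIm _ _)).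
by rewrite [leRHS]splitr lerD// distrC.
Qed.

(** * Power series of radius of convergence at least 1 *)

(** Abel's form of the condition: bounded terms at every radius below 1. Boundedness is easy to
    check, and summability follows by passing to a slightly larger radius. *)
Definition unit_radius a :=
  forall r, 0 <= r < 1 -> exists K, forall n, cmod (a n) * r ^+ n <= K.

Definition psum a z : R[i] := limn (series (fun n => a n * z ^+ n) : nat -> R[i]^o).

Definition pdiff a n : R[i] := n.+1%:R * a n.+1.

Lemma cmod_nat n : cmod (n%:R : R[i]) = n%:R.
Proof. by rewrite -(rmorph_nat (real_complex R)) cmodR normr_nat. Qed.

(** For [r < s < 1] and q = r/s, the factor n+1 is absorbed by (n+1) q^n <= 1 + q + ... + q^n <=
    1/(1-q), at the cost of moving from radius [r] to [s]. *)
Lemma unit_radius_pdiff a : unit_radius a -> unit_radius (pdiff a).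
Proof.
move=> ha r /andP[r0 r1].
have [s [s0 s1 rs]] : exists s : R, [/\ 0 < s, s < 1 & r < s].
  by exists ((1 + r) / 2); split; lra.
have [K hK] := ha s (introT andP (conj (ltW s0) s1)).
have K0 : 0 <= K by rewrite (le_trans _ (hK 0%N))// mulr_ge0 ?cmod_ge0 ?exprn_ge0// ltW.
pose q := r / s; have q0 : 0 <= q by rewrite divr_ge0// ltW.
have q1 : q < 1 by rewrite /q ltr_pdivrMr// mul1r.
have hq n : n.+1%:R * q ^+ n <= (1 - q)^-1.
  have h : n.+1%:R * q ^+ n <= \sum_(i < n.+1) q ^+ i.
    rewrite mulr_natl -[X in _ *+ X](card_ord n.+1) -sumr_const ler_sum// => i _.
    by rewrite ler_wiXn2l ?leq_ord // ltW.
  rewrite (le_trans h)// -div1r ler_pdivlMr ?subr_gt0//.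
  have -> : (\sum_(i < n.+1) q ^+ i) * (1 - q) = 1 - q ^+ n.+1.
    by rewrite mulrC -(opprB q 1) mulNr -subrX1 opprB.
  by rewrite gerBl exprn_ge0.
exists (K / s / (1 - q)) => n.
have -> : cmod (pdiff a n) * r ^+ n =
    (cmod (a n.+1) * s ^+ n.+1) / s * (n.+1%:R * q ^+ n).
  rewrite /pdiff cmodM cmod_nat /q expr_div_n exprS; field.
  by rewrite expf_neq0 gt_eqF.
apply: ler_pM; rewrite ?hq //.
- by rewrite mulr_ge0 ?invr_ge0 ?mulr_ge0 ?cmod_ge0 ?exprn_ge0 // ltW.
- by rewrite mulr_ge0 // exprn_ge0.
- by rewrite ler_pM2r ?invr_gt0.
Qed.

(** Comparison with a geometric series of ratio r/s, where [r < s < 1] and the terms are bounded at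
    radius [s]. *)
Lemma unit_radius_cvg a r : unit_radius a -> 0 <= r < 1 ->
  cvgn (series (fun n => cmod (a n) * r ^+ n)).
Proof.
move=> ha /andP[r0 r1].
have [s [s0 s1 rs]] : exists s : R, [/\ 0 < s, s < 1 & r < s].
  by exists ((1 + r) / 2); split; lra.
have [K hK] := ha s (introT andP (conj (ltW s0) s1)).
have K0 : 0 <= K by rewrite (le_trans _ (hK 0%N))// mulr_ge0 ?cmod_ge0 ?exprn_ge0// ltW.
have q0 : 0 <= r / s by rewrite divr_ge0// ltW.
have q1 : `|r / s| < 1 by rewrite ger0_norm// ltr_pdivrMr// mul1r.
have gc : cvgn (series (geometric K (r / s))) := @is_cvg_geometric_series R K _ q1.
apply: (series_le_cvg _ _ _ gc) => n.
- by rewrite mulr_ge0 ?cmod_ge0 ?exprn_ge0.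
- by rewrite /geometric /= mulr_ge0 ?exprn_ge0.
rewrite /geometric /= expr_div_n mulrCA [leLHS]mulrC ler_wpM2l//.
  by rewrite exprn_ge0.
by rewrite ler_pdivlMr ?exprn_gt0.
Qed.

Lemma psum_cvg a z : unit_radius a -> unit_disc z ->
  (series (fun n => a n * z ^+ n) : nat -> R[i]^o) @ \oo --> (psum a z : R[i]^o).
Proof.
move=> ha z1; apply: abs_cvg_series.
under eq_fun do rewrite cmodM cmodX.
by apply: unit_radius_cvg => //; rewrite cmod_ge0.
Qed.

Lemma psum0 a : psum a 0 = a 0%N.
Proof.
apply: (cvg_lim (@norm_hausdorff _ R[i]^o)).
apply/cvg_cmodP => e e0; exists 1%N => // n /= n1.
case: n n1 => // n _; rewrite /series /= big_nat_recl//= expr0 mulr1 big1 ?addr0.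
  by rewrite subrr cmod0 ltW.
by move=> i _; rewrite expr0n mulr0.
Qed.

(** * Termwise differentiation by a second-order remainder estimate *)

Lemma taylor_remainder_step z h n :
  (z + h) ^+ n.+2 - z ^+ n.+2 - n.+2%:R * h * z ^+ n.+1 =
  (z + h) * ((z + h) ^+ n.+1 - z ^+ n.+1 - n.+1%:R * h * z ^+ n)
  + n.+1%:R * h ^+ 2 * z ^+ n.
Proof. by rewrite -[in LHS]natr1 !exprS; ring. Qed.

(** The factor (n+2)(n+1) is that of the second derived series, so these bounds sum to a convergent
    series. The induction closes because (n+2)(n+1) + (n+2) <= (n+3)(n+2). *)
Lemma taylor_remainder z h r n : cmod z <= r -> cmod (z + h) <= r ->
  cmod ((z + h) ^+ n.+2 - z ^+ n.+2 - n.+2%:R * h * z ^+ n.+1) <=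
  cmod h ^+ 2 * (n.+2%:R * n.+1%:R * r ^+ n).
Proof.
move=> zr zhr; have r0 : 0 <= r := le_trans (cmod_ge0 z) zr.
elim: n => [|n IH].
  have -> : (z + h) ^+ 2 - z ^+ 2 - 2%:R * h * z ^+ 1 = h ^+ 2 by ring.
  by rewrite cmodX expr0 mulr1 ler_peMr ?sqr_ge0// mulr1 ler1n.
rewrite taylor_remainder_step (le_trans (cmodD _ _))// !cmodM cmod_nat !cmodX.
have h1 := ler_pM (cmod_ge0 _) (cmod_ge0 _) zhr IH.
have h2 : n.+2%:R * cmod h ^+ 2 * cmod z ^+ n.+1 <= n.+2%:R * cmod h ^+ 2 * r ^+ n.+1.
  apply: ler_wpM2l; first by rewrite mulr_ge0 ?sqr_ge0.
  by apply: lerXn2r; rewrite ?nnegrE ?cmod_ge0.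
apply: (le_trans (lerD h1 h2)).
rewrite -[n.+3%:R]natr1 -[n.+2%:R]natr1 (exprS r n).
have : 0 <= cmod h ^+ 2 * (n.+1%:R + 1) * (r * r ^+ n).
  by rewrite mulr_ge0 ?mulr_ge0 ?exprn_ge0 ?cmod_ge0 ?addr_ge0 // ?sqr_ge0.
by nra.
Qed.

(** Summing the monomial remainders gives K as the sum of the twice derived series, with absolute
    values, at radius [r]; it serves all [z] and [h] at once. *)
Lemma psum_quad_bound a r : unit_radius a -> 0 <= r < 1 ->
  exists2 K, 0 <= K & forall z h, cmod z <= r -> cmod (z + h) <= r ->
  cmod (psum a (z + h) - psum a z - h * psum (pdiff a) z) <= cmod h ^+ 2 * K.
Proof.
move=> ha r01.
have ha1 := unit_radius_pdiff ha; have ha2 := unit_radius_pdiff ha1.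
have cK := unit_radius_cvg ha2 r01.
have ndK : nondecreasing_seq (series (fun n => cmod (pdiff (pdiff a) n) * r ^+ n)).
  apply/nondecreasing_series => n _ _; rewrite mulr_ge0 ?cmod_ge0 ?exprn_ge0//.
  by case/andP: r01.
set K := limn (series (fun n => cmod (pdiff (pdiff a) n) * r ^+ n)) in cK.
exists K.
  by have := nondecreasing_cvgn_le ndK cK 0%N; rewrite /series /= big_nil.
move=> z h zr zhr; have /andP[r0 r1] := r01.
have shift k b w : unit_radius b -> cmod w <= r ->
    (fun N => series (fun n => b n * w ^+ n) (N + k)%N : R[i]^o) @ \oo -->
    (psum b w : R[i]^o).
  move=> hb wr; apply: (cvg_comp _ _ (cvg_addnr k)).
  exact: psum_cvg (le_lt_trans wr r1).
(* The shifts by 2 and 1 align the partial sums: the constant terms cancel, the linear ones cancel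
   against the first term of the derived series, and what is left starts at [a 2]. *)
pose D N := series (fun n => a n * (z + h) ^+ n) (N + 2)%N
    - series (fun n => a n * z ^+ n) (N + 2)%N
    - h * series (fun n => pdiff a n * z ^+ n) (N + 1)%N.
have cD : (D : nat -> R[i]^o) @ \oo -->
    (psum a (z + h) - psum a z - h * psum (pdiff a) z : R[i]^o).
  apply: cvgB; first by apply: cvgB; exact: shift.
  by apply: (@cvgM R[i]); [exact: cvg_cst|exact: shift].
apply: (cvg_cmod_le cD); apply: nearW => N; rewrite /D.
have -> : series (fun n => a n * (z + h) ^+ n) (N + 2)%N
    - series (fun n => a n * z ^+ n) (N + 2)%N
    - h * series (fun n => pdiff a n * z ^+ n) (N + 1)%N =
    \sum_(0 <= n < N) a n.+2 *
      ((z + h) ^+ n.+2 - z ^+ n.+2 - n.+2%:R * h * z ^+ n.+1).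
  rewrite addn2 addn1 /series /=; elim: N => [|N IH].
    rewrite !big_nat_recr ?big_nil //= /pdiff; ring.
  rewrite [RHS]big_nat_recr //= -IH.
  rewrite [X in X - _ - _]big_nat_recr //= [X in _ - X - _]big_nat_recr //=.
  rewrite [X in _ - _ * X]big_nat_recr //= /pdiff; ring.
apply: (le_trans (cmod_sum _ _)).
apply: (@le_trans _ _ (cmod h ^+ 2 *
    series (fun n => cmod (pdiff (pdiff a) n) * r ^+ n) N)).
  rewrite /series /= mulr_sumr; apply: ler_sum => n _.
  rewrite cmodM /pdiff !cmodM !cmod_nat.
  have := ler_wpM2l (cmod_ge0 (a n.+2)) (taylor_remainder n zr zhr).
  by move/le_trans; apply; rewrite le_eqVlt; apply/orP; left; apply/eqP; ring.
by rewrite ler_wpM2l ?sqr_ge0 //; exact: nondecreasing_cvgn_le.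
Qed.

Lemma unit_disc_near z : unit_disc z -> \forall w \near (z : R[i]^o), unit_disc w.
Proof.
move=> z1; apply/nbhs_ballP; exists (1 - cmod z)%:C.
  by rewrite /= ltcR subr_gt0.
move=> w; rewrite /ball /= /ball_ distrC normE ltcR => wz.
rewrite /unit_disc /=; have -> : w = (w - z) + z by rewrite subrK.
by rewrite (le_lt_trans (cmodD _ _))// -ltrBrDr.
Qed.

Lemma is_derive_psum a z : unit_radius a -> unit_disc z ->
  is_derive (z : R[i]^o) (1 : R[i]^o) (psum a : R[i]^o -> R[i]^o) (psum (pdiff a) z).
Proof.
move=> ha z1.
have z0 := cmod_ge0 z; have z1' : cmod z < 1 := z1.
have [r [r0 rz r1]] : exists r : R, [/\ 0 <= r, cmod z < r & r < 1].
  by exists ((1 + cmod z) / 2); split; lra.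
have [K K0 hK] := psum_quad_bound ha (introT andP (conj r0 r1)).
apply: is_derive_eps => e; rewrite ltcE /= => /andP[/eqP eIm e0].
have {eIm}-> : e = (complex.Re e)%:C by case: e eIm e0 => ? ? /= ->.
move: (complex.Re e) e0 => {}e e0.
(* The first bound keeps [z + h] in the disc of radius [r]; the second makes |h| K <= e, with
   [K + 1] guarding against [K = 0]. *)
pose d := Num.min (r - cmod z) (e / (K + 1)).
have d0 : 0 < d by rewrite lt_min subr_gt0 rz divr_gt0// ltr_wpDl.
exists d%:C; first by rewrite ltcR.
move=> h h0; rewrite normE ltcR lt_min => /andP[hr he].
have hz : cmod (z + h) <= r.
  by rewrite (le_trans (cmodD _ _))// addrC -lerBrDr ltW.
have ch0 : 0 < cmod h.
  rewrite lt_neqAle cmod_ge0 andbT eq_sym; apply: contra h0 => /eqP.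
  by move/cmod_eq0 => ->.
rewrite normE lecR.
have -> : h^-1 * (psum a (z + h) - psum a z) - psum (pdiff a) z =
   h^-1 * (psum a (z + h) - psum a z - h * psum (pdiff a) z).
  by rewrite [RHS]mulrBr mulrA mulVf // mul1r.
rewrite cmodM -(ler_pM2l ch0) mulrA -cmodM divff // /cmod Normc.normc1 mul1r.
apply: (le_trans (hK _ _ (ltW rz) hz)).
rewrite expr2 -mulrA ler_pM2l //.
have : cmod h * (K + 1) < e by rewrite -ltr_pdivlMr // ltr_wpDl.
by have := cmod_ge0 h; lra.
Qed.

Lemma psum_analytic a : unit_radius a -> analytic_in_disc (psum a).
Proof. by move=> ha z z1; have [] := is_derive_psum ha z1. Qed.

(** * Recovering the coefficients from the derivatives at 0 *)

Lemma derive1n_psum n a z : unit_radius a -> unit_disc z ->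
  ((psum a : R[i] -> R[i]^o)^`(n))%classic z = psum (iter n pdiff a) z.
Proof.
move=> ha; have hn m : unit_radius (iter m pdiff a).
  by elim: m => //= m IH; exact: unit_radius_pdiff.
elim: n z => [//|n IH] z z1; rewrite derive1nS derive1E.
(* The induction hypothesis holds on the disc only; since the disc is open, this is enough for the
   derivative at [z]. *)
rewrite (@near_eq_derive _ _ _ _ (psum (iter n pdiff a) : R[i]^o -> R[i]^o)).
  by have [_ ->] := is_derive_psum (hn n) z1.
by apply: filterS (unit_disc_near z1).
Qed.

Lemma iter_pdiff0 n m a : iter n pdiff a m = ((n + m) ^_ n)%:R * a (n + m)%N.
Proof.
elim: n m => [|n IH] m /=; first by rewrite ffactn0 mul1r.
rewrite /pdiff IH addnS mulrA -natrM; congr (_%:R * _).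
by rewrite addSn ffactnSr mulnC; congr (_ * _)%N; rewrite -addnS addKn.
Qed.

Lemma unit_disc_real r : 0 <= r < 1 -> unit_disc r%:C.
Proof.
move=> /andP[r0 r1]; suff : cmod r%:C < 1 by [].
by rewrite cmodR ger0_norm.
Qed.

Lemma taylor_coef_psum a n : unit_radius a -> taylor_coef (psum a) n = a n.
Proof.
move=> ha; rewrite /taylor_coef derive1n_psum //; last first.
  by apply: (@unit_disc_real 0); rewrite lexx ltr01.
rewrite psum0 iter_pdiff0 addn0 ffactnn mulrAC divff ?mul1r //.
Qed.

End ComplexSeries.

(** * Tails and moments of a radial weight *)

Section Weight.
Variables (R : realType) (mu : R -> R).
Hypothesis mu_weight : radial_weight mu.
Local Notation leb := (@lebesgue_measure R).

(** The weight tail as a function of the radius: [weight_tail mu z] unfolds to its value at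
    [cmod z]. *)
Definition tail_integral r := Rintegral leb `[r, 1[ mu.
Local Notation T := tail_integral.

Let mu_ge0 r : 0 <= r < 1 -> 0 <= mu r.
Proof. by case: mu_weight => + _; exact. Qed.

Let mu_int : leb.-integrable `[0, 1[ (EFin \o mu).
Proof. by case: mu_weight. Qed.

Lemma ge0_le_Rintegral_subset (A B : set R) (f : R -> R) :
  measurable A -> measurable B -> A `<=` B -> leb.-integrable B (EFin \o f) ->
  (forall x, B x -> 0 <= f x) ->
  Rintegral leb A f <= Rintegral leb B f.
Proof.
move=> mA mB AB fi f0; rewrite fine_le //.
- by apply: integrable_fin_num => //; exact: integrableS fi.
- exact: integrable_fin_num.
apply: ge0_subset_integral => //.
  exact: (measurable_int leb).
Qed.

Lemma tail_integral_le r s : 0 <= r <= s -> T s <= T r.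
Proof.
move=> /andP[r0 rs]; apply: ge0_le_Rintegral_subset => //.
- by apply: subset_itvr; rewrite bnd_simp.
- by apply: integrableS mu_int => //; apply: subset_itvr; rewrite bnd_simp.
- move=> x /=; rewrite in_itv /= => /andP[rx x1].
  by rewrite mu_ge0 // x1 (le_trans r0 rx).
Qed.

(** Absolute continuity of the integral, applied to [mu] extended by zero outside [[0, 1[]. *)
Lemma tail_integral_small e : 0 < e -> exists r, 0 <= r < 1 /\ T r <= e.
Proof.
move=> e0.
have fi : leb.-integrable setT (EFin \o mu \_ `[0, 1[).
  by rewrite -restrict_EFin; apply/integrable_restrict => //=; rewrite setTI.
have [d [d0 hd]] := integral_normr_continuous fi e0.
(* The interval [[r, 1[] then has length at most d/2, and the maximum keeps [r] nonnegative. *)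
pose r := Num.max 0 (1 - d / 2).
have r0 : 0 <= r by rewrite le_max lexx.
have r1 : r < 1 by rewrite gt_max ltr01 /= gtrBl divr_gt0.
exists r; rewrite r0 r1; split => //; apply/ltW.
have -> : T r = Rintegral leb `[r, 1[ (fun x => `|(mu \_ `[0%R, 1%R[) x|).
  apply: eq_Rintegral => x; rewrite inE /= in_itv /= => /andP[rx x1].
  rewrite patchE ifT; last by rewrite inE /= in_itv /= x1 (le_trans r0 rx).
  by rewrite ger0_norm // mu_ge0 // x1 (le_trans r0 rx).
have rd : 1 - d / 2 <= r by rewrite le_max lexx orbT.
apply: hd => //; suff : (leb `[r, 1%R[ < d%:E)%E by [].
by rewrite lebesgue_measure_itv /= lte_fin r1 -EFinD lte_fin; lra.
Qed.

(** Restrict the moment integral to [[r, 1[], where x^n >= r^n. This prevents the moments from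
    decaying faster than geometrically with ratio [r], for every [r < 1]. *)
Lemma weight_moment_ge n r : 0 <= r < 1 ->
  r ^+ n * T r <= weight_moment mu n%:R.
Proof.
move=> /andP[r0 r1].
have sub : `[r, 1[%classic `<=` (`[0, 1[%classic : set R).
  by apply: subset_itvr; rewrite bnd_simp.
have iM : leb.-integrable `[0, 1[ (EFin \o (fun x => x `^ n%:R * mu x)).
  apply: (@le_integrable _ (measurableTypeR R) R leb _ (measurable_itv _) _ _ _ _ mu_int).
    apply/measurable_EFinP; apply: measurable_funM; last first.
      by apply/measurable_EFinP; exact: (measurable_int leb).
    by apply: measurable_funTS; exact: measurable_powR.
  move=> x /=; rewrite in_itv /= => /andP[x0 x1].
  rewrite lee_fin normrM ler_piMl // powR_mulrn // ger0_norm ?exprn_ge0 //.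
  by rewrite exprn_ile1 // ltW.
rewrite /weight_moment.
apply: (@le_trans _ _ (Rintegral leb `[r, 1[ (fun x => x `^ n%:R * mu x))).
  rewrite /T -RintegralZl //; last exact: integrableS mu_int.
  apply: le_Rintegral => //.
  - have -> : EFin \o (fun x => r ^+ n * mu x) =
        (fun x => (r ^+ n)%:E * (EFin \o mu) x)%E.
      by apply/funext => x; rewrite /= EFinM.
    by apply: integrableZl => //; exact: integrableS mu_int.
  - exact: integrableS iM.
  move=> x /=; rewrite in_itv /= => /andP[rx x1].
  have x0 := le_trans r0 rx.
  rewrite powR_mulrn // ler_wpM2r ?mu_ge0 ?x0 // lerXn2r ?nnegrE //.
apply: ge0_le_Rintegral_subset => //.
move=> x /=; rewrite in_itv /= => /andP[x0 x1].
by rewrite mulr_ge0 ?powR_ge0 // mu_ge0 ?x0.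
Qed.

End Weight.

(** * Sparse coefficients and the gliding hump *)

Section SparseCoefficients.
Variable R : realType.
Implicit Types (c x : nat -> R) (nu : nat -> nat).

(* The coefficient of z^n in sum_k c_k z^(nu_k): the range k <= n suffices when
   nu_k >= k, and nu need not be injective. *)
Definition sparse c nu n : R := \sum_(0 <= k < n.+1) c k * (nu k == n)%:R.

(** An index k > n has [nu k] > n, so its indicator vanishes. *)
Lemma sparse_widen c nu n N : (forall k, (k <= nu k)%N) -> (n < N)%N ->
  sparse c nu n = \sum_(0 <= k < N) c k * (nu k == n)%:R.
Proof.
move=> hnu nN; rewrite [RHS](@big_cat_nat _ _ _ n.+1) //=.
rewrite [X in _ + X]big1_seq ?addr0 //.
move=> k; rewrite mem_index_iota => /andP[_ /andP[nk _]].
by rewrite gtn_eqF ?mulr0 // (leq_trans nk).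
Qed.

(** Exchange the two sums; for fixed k only n = [nu k] survives, and only if it is below N. *)
Lemma sum_sparse c nu x N : (forall k, (k <= nu k)%N) ->
  \sum_(0 <= n < N) sparse c nu n * x n =
  \sum_(0 <= k < N) c k * ((nu k < N)%:R * x (nu k)).
Proof.
move=> hnu; transitivity
    (\sum_(0 <= n < N) \sum_(0 <= k < N) c k * (nu k == n)%:R * x n).
  apply: eq_big_nat => n /andP[_ nN].
  by rewrite (sparse_widen c hnu nN) mulr_suml.
rewrite exchange_big_nat /=; apply: eq_bigr => k _.
under eq_bigr do rewrite -mulrA.
rewrite -mulr_sumr; congr (_ * _).
rewrite big_mkord; case: ltnP => [kN|Nk].
  rewrite (bigD1 (Ordinal kN)) //= eqxx big1 ?addr0 //.
  by move=> i; rewrite -val_eqE /= eq_sym => /negbTE ->; rewrite mul0r.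
by rewrite mul0r big1 // => i _; rewrite gtn_eqF ?mul0r // (leq_trans (ltn_ord i)).
Qed.

Lemma sum_sparse_le c nu x N : (forall k, (k <= nu k)%N) ->
  (forall k, 0 <= c k) -> (forall n, 0 <= x n) ->
  \sum_(0 <= n < N) sparse c nu n * x n <= \sum_(0 <= k < N) c k * x (nu k).
Proof.
move=> hnu c0 x0; rewrite sum_sparse //; apply: ler_sum => k _.
by rewrite ler_wpM2l // ler_piMl //; case: (_ < _)%N.
Qed.

Lemma sum_sparse_ge c nu x K : (forall k, (k <= nu k)%N) ->
  (forall k, 0 <= c k) -> (forall n, 0 <= x n) ->
  exists N, \sum_(0 <= k < K) c k * x (nu k) <= \sum_(0 <= n < N) sparse c nu n * x n.
Proof.
(* The sum exceeds no less than each single [nu k] with k < K, and the summand [K] ensures that the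
   cutoff is beyond [K] itself. *)
move=> hnu c0 x0; exists (K + \sum_(0 <= k < K) nu k).+1.
rewrite sum_sparse // [leRHS](@big_cat_nat _ _ _ K) //=; last by rewrite leqW ?leq_addr.
apply: (@le_trans _ _ (\sum_(0 <= k < K) c k * x (nu k) + 0)); first by rewrite addr0.
apply: lerD; last by apply: sumr_ge0 => k _; rewrite !mulr_ge0.
apply: ler_sum_nat => k /andP[_ kK].
suff -> : (nu k < (K + \sum_(0 <= k < K) nu k).+1)%N by rewrite mul1r.
rewrite ltnS (leq_trans _ (leq_addl _ _)) // big_mkord.
by rewrite (bigD1 (Ordinal kK)) //= leq_addr.
Qed.

Lemma sparse_ge0 c nu n : (forall k, 0 <= c k) -> 0 <= sparse c nu n.
Proof. by move=> c0; apply: sumr_ge0 => k _; rewrite mulr_ge0. Qed.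

Lemma sparse_le c nu n : (forall k, 0 <= c k <= 1) -> sparse c nu n <= n.+1%:R.
Proof.
move=> c01; rewrite -[n.+1 in leRHS]subn0 -[leRHS]mulr1 mulr_natl -sumr_const_nat.
apply: ler_sum => k _; have /andP[c0 c1] := c01 k.
by case: (nu k == n); rewrite ?mulr1 ?mulr0.
Qed.

Lemma sum_half N : \sum_(0 <= k < N) (2^-1 : R) ^+ k <= 2.
Proof.
suff -> : \sum_(0 <= k < N) (2^-1 : R) ^+ k = 2 - 2 * 2^-1 ^+ N.
  by rewrite gerBl mulr_ge0 ?exprn_ge0.
elim: N => [|N IH]; first by rewrite big_nil expr0 mulr1 subrr.
by rewrite big_nat_recr //= IH exprS; field.
Qed.

Lemma bernoulli_le (x : R) n : 0 <= x <= 1 -> 1 - n%:R * x <= (1 - x) ^+ n.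
Proof.
move=> /andP[x0 x1]; elim: n => [|n IH]; first by rewrite mul0r subr0.
rewrite exprS -natr1; apply: (@le_trans _ _ ((1 - x) * (1 - n%:R * x))).
  have : 0 <= n%:R * x * x by rewrite !mulr_ge0.
  by nra.
by rewrite ler_wpM2l // subr_ge0.
Qed.

(** Bernoulli's inequality at x = 1/(2(n+1)) gives (1-x)^n >= 1 - nx = 1/2 + x. *)
Lemma near1_power n : exists r : R, 0 <= r < 1 /\ 2^-1 <= r ^+ n.
Proof.
have p : 0 < n%:R + 1 :> R by rewrite ltr_wpDl.
pose x : R := (2 * (n%:R + 1))^-1.
have x0 : 0 < x by rewrite invr_gt0 mulr_gt0.
have nx : n%:R * x + x = 2^-1.
  by rewrite /x; field; rewrite gt_eqF.
have n0 : 0 <= n%:R * x by rewrite mulr_ge0 // ltW.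
exists (1 - x); split; first by apply/andP; split; lra.
have := @bernoulli_le x n; have -> : 0 <= x <= 1 by apply/andP; split; lra.
by move=> /(_ isT); lra.
Qed.

End SparseCoefficients.

(** * Weighted monomials, for a tail and moments known only through four properties *)

Section PeakingMonomials.
Variables (R : realType) (T : R -> R) (m : nat -> R).
Hypothesis T_gt0 : forall r, 0 <= r < 1 -> 0 < T r.
Hypothesis T_le : forall r s, 0 <= r <= s -> T s <= T r.
Hypothesis T_small : forall e, 0 < e -> exists r, 0 <= r < 1 /\ T r <= e.
Hypothesis m_ge : forall n r, 0 <= r < 1 -> r ^+ (2 * n + 1) * T r <= m n.

Lemma moment_gt0 n : 0 < m n.
Proof.
have h : 0 <= (2^-1 : R) < 1 by apply/andP; split; lra.
by apply: lt_le_trans (m_ge n h); rewrite mulr_gt0 ?exprn_gt0 ?T_gt0 // invr_gt0.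
Qed.

(** The exponent 2n+1 in the moment bound calls for r < s^2: then r^n / m_n <= (r/s^2)^n / (s
    T(s)). *)
Lemma power_over_moment r : 0 <= r < 1 ->
  exists K q, [/\ 0 <= K, 0 <= q < 1 & forall n, r ^+ n / m n <= K * q ^+ n].
Proof.
move=> /andP[r0 r1]; have [s [s0 s1 rs]] : exists s, [/\ 0 < s, s < 1 & r < s * s].
  (* Here s^2 - r = ((1-r)/2)^2 > 0. *)
  by exists ((1 + r) / 2); split; nra.
have s01 : 0 <= s < 1 by rewrite s1 ltW.
have Ts := T_gt0 s01.
exists (s * T s)^-1, (r / (s * s)); split.
- by rewrite invr_ge0 mulr_ge0 // ltW.
- by rewrite divr_ge0 ?ltr_pdivrMr ?mul1r ?mulr_gt0 // mulr_ge0 // ltW.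
move=> n; rewrite ler_pdivrMr ?moment_gt0 //.
apply: le_trans (ler_wpM2l _ (m_ge n s01)); last first.
  by rewrite mulr_ge0 ?invr_ge0 ?exprn_ge0 ?divr_ge0 ?mulr_ge0 // ltW.
have -> : s ^+ (2 * n + 1) = (s * s) ^+ n * s by rewrite addn1 exprSr exprM expr2.
have Q0 : 0 < (s * s) ^+ n by rewrite exprn_gt0 // mulr_gt0.
rewrite expr_div_n; move: (_ ^+ n) Q0 => Q Q0.
rewrite le_eqVlt; apply/orP; left; apply/eqP; field.
by rewrite !gt_eqF.
Qed.

(** The function G_n: the weighted fractional derivative of z^n at radius r. *)
Definition peak n r := T r * (r ^+ n / m n).

Lemma peak_ge0 n r : 0 <= r < 1 -> 0 <= peak n r.
Proof.
move=> r01; have /andP[r0 _] := r01.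
by rewrite mulr_ge0 ?divr_ge0 ?exprn_ge0 // ltW ?moment_gt0 ?T_gt0.
Qed.

Lemma peak_le n r : 0 <= r < 1 -> peak n r <= T 0 / m n.
Proof.
move=> /andP[r0 r1]; rewrite /peak mulrA ler_pM2r ?invr_gt0 ?moment_gt0 //.
rewrite -[leRHS]mulr1 ler_pM ?exprn_ge0 ?exprn_ile1 ?T_le ?lexx ?r0 // ltW //.
by rewrite T_gt0 // r0.
Qed.

Lemma peak_small_right n e : 0 < e -> exists rho, 0 <= rho < 1 /\
  forall r, rho <= r < 1 -> peak n r <= e.
Proof.
move=> e0; have [rho [rho01 hr]] := T_small (mulr_gt0 e0 (moment_gt0 n)).
exists rho; split=> // r /andP[rr r1]; have /andP[rho0 rho1] := rho01.
have r0 := le_trans rho0 rr.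
rewrite /peak mulrA ler_pdivrMr ?moment_gt0 //; apply: le_trans hr.
apply: (@le_trans _ _ (T r)); last by rewrite T_le // rho0.
by rewrite ler_piMr ?exprn_ile1 // ltW // T_gt0 // r0.
Qed.

Lemma peak_small_left rho e : 0 <= rho < 1 -> 0 < e -> exists N, forall n r,
  (N <= n)%N -> 0 <= r <= rho -> peak n r <= e.
Proof.
move=> rho01 e0; have [K [q [K0 /andP[q0 q1] hK]]] := power_over_moment rho01.
have /andP[rho0 rho1] := rho01.
have T00 : 0 < T 0 by rewrite T_gt0 // lexx ltr01.
have q1' : `|q| < 1 by rewrite ger0_norm.
have /cvgrPdist_le /(_ _ e0) [N _ hN] := cvg_geometric (T 0 * K) q1'.
exists N => n r Nn /andP[r0 rr].
apply: le_trans (hN n Nn); rewrite sub0r normrN ger0_norm; last first.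
  by rewrite /geometric /= !mulr_ge0 ?exprn_ge0 // ltW.
rewrite /geometric /= -mulrA ler_pM //.
- by rewrite ltW // T_gt0 // r0 (le_lt_trans rr).
- by rewrite divr_ge0 ?exprn_ge0 // ltW // moment_gt0.
- by rewrite T_le // lexx.
apply: le_trans (hK n); rewrite ler_pM2r ?invr_gt0 ?moment_gt0 //.
by apply: lerXn2r; rewrite ?nnegrE.
Qed.

(** Exponents and radii are chosen alternately so that the k-th peak is at most 2^-k outside the
    interval between the k-th and the next radius. A given r lies inside at most one such interval,
    where the bound C is spent; the rest sums to at most 2. *)
Lemma gliding_hump C : (forall n r, 0 <= r < 1 -> peak n r <= C) ->
  exists nu, (forall k, (k <= nu k)%N) /\
  forall N r, 0 <= r < 1 -> \sum_(0 <= k < N) peak (nu k) r <= C + 2.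
Proof.
move=> hC.
(* [x] holds the stage and the current radius, [y] the chosen exponent and the next radius. The
   premise on [x.2] makes the relation total, as the choice principle requires. *)
pose P (x : nat * R) (y : nat * R) := 0 <= x.2 < 1 ->
  [/\ (x.1 <= y.1)%N, x.2 <= y.2, y.2 < 1,
    forall r, 0 <= r <= x.2 -> peak y.1 r <= 2^-1 ^+ x.1 &
    forall r, y.2 <= r < 1 -> peak y.1 r <= 2^-1 ^+ x.1].
have [F FP] : {F & forall x, P x (F x)}.
  apply: choice => -[k rho]; case: (boolP (0 <= rho < 1)) => [rho01|h]; last first.
    (* Dummy value for radii outside [[0, 1[], where the premise fails. *)
    by exists (0%N, 0) => /= h'; rewrite /= h' in h.
  have e0 : 0 < (2^-1 : R) ^+ k by rewrite exprn_gt0.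
  have [N hN] := peak_small_left rho01 e0.
  have [s [/andP[s0 s1] hs]] := peak_small_right (maxn k N) e0.
  have /andP[rho0 rho1] := rho01.
  exists (maxn k N, Num.max rho s) => _ /=; split.
  - by rewrite leq_maxl.
  - by rewrite le_max lexx.
  - by rewrite gt_max rho1.
  - by move=> r hr; apply: hN => //; rewrite leq_maxr.
  - by move=> r /andP[]; rewrite ge_max => /andP[_ sr] r1; apply: hs; rewrite sr.
pose rho := fix rho k := if k is k'.+1 then (F (k', rho k')).2 else 0.
have rho01 k : 0 <= rho k < 1.
  elim: k => [|k IH]; first by rewrite lexx ltr01.
  have [_ h1 h2 _ _] := FP (k, rho k) IH.
  by rewrite /= h2 andbT (le_trans _ h1) //; case/andP: IH.
exists (fun k => (F (k, rho k)).1); split=> [k|N r r01].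
  by have [] := FP (k, rho k) (rho01 k).
have C0 : 0 <= C := le_trans (peak_ge0 0 r01) (hC 0%N r r01).
have /andP[r0 r1] := r01.
pose S N := \sum_(0 <= k < N) peak (F (k, rho k)).1 r.
pose H N := \sum_(0 <= k < N) (2^-1 : R) ^+ k.
(* The second conjunct strengthens the induction: once r is beyond [rho N], all previous humps have
   been passed and C is still available for the next one. *)
suff [h _] : S N <= C + H N /\ (rho N <= r -> S N <= H N).
  by apply: (le_trans h); rewrite lerD2l sum_half.
elim: N => [|N [IH1 IH2]]; first by rewrite /S /H !big_nil addr0.
have -> : S N.+1 = S N + peak (F (N, rho N)).1 r by rewrite /S big_nat_recr.
have -> : H N.+1 = H N + 2^-1 ^+ N by rewrite /H big_nat_recr.
have [_ h1 h2 h3 h4] := FP (N, rho N) (rho01 N).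
have e0 : 0 <= (2^-1 : R) ^+ N by rewrite exprn_ge0.
split.
  have [rr|rr] := leP r (rho N).
    by rewrite addrA lerD // h3 // r0.
  apply: (@le_trans _ _ (H N + C)); first by rewrite lerD ?IH2 ?hC // ltW.
  by lra.
move=> hr; rewrite lerD ?IH2 //; first exact: le_trans hr.
by rewrite h4 // hr.
Qed.

(** If stage k failed, all peaks with n >= k would stay below 4^k, and the finitely many others are
    bounded individually, so the peaks would be uniformly bounded. *)
Lemma unbounded_peaks :
  ~ (exists C, forall n r, 0 <= r < 1 -> peak n r <= C) ->
  exists nu rho, forall k, [/\ (k <= nu k)%N, 0 <= rho k < 1 &
    4 ^+ k <= peak (nu k) (rho k)].
Proof.
move=> nb.
have [F FP] : {F : nat -> nat * R & forall k, [/\ (k <= (F k).1)%N, 0 <= (F k).2 < 1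
    & 4 ^+ k <= peak (F k).1 (F k).2]}.
  apply: (@choice _ _ (fun k p =>
    [/\ (k <= p.1)%N, 0 <= p.2 < 1 & 4 ^+ k <= peak p.1 p.2])) => k.
  apply: contrapT => hk; apply: nb.
  exists (4 ^+ k + \sum_(i < k) T 0 / m i) => n r r01.
  have Tm i : 0 <= T 0 / m i.
    by rewrite divr_ge0 // ltW ?moment_gt0 // T_gt0 ?lexx ?ltr01.
  have [kn|nk] := leqP k n.
    apply: (@le_trans _ _ (4 ^+ k)); last by rewrite lerDl sumr_ge0.
    by apply/ltW; rewrite ltNge; apply/negP => h; apply: hk; exists (n, r).
  apply: (le_trans (peak_le n r01)).
  by rewrite (bigD1 (Ordinal nk)) //= addrCA lerDl addr_ge0 ?exprn_ge0 // sumr_ge0.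
by exists (fun k => (F k).1), (fun k => (F k).2).
Qed.

End PeakingMonomials.

(** * Sparse power series in the two spaces *)

Section NonnegativeSeries.
Variable R : realType.
Implicit Types (c alpha : nat -> R) (nu : nat -> nat).

Lemma cmod_psum_le alpha (z : R[i]) (B : R) : unit_radius (fun n => (alpha n)%:C) ->
  unit_disc z -> (forall n, 0 <= alpha n) ->
  (forall N, \sum_(0 <= n < N) alpha n * cmod z ^+ n <= B) ->
  cmod (psum (fun n => (alpha n)%:C) z) <= B.
Proof.
move=> ha z1 a0 hB; apply: (cvg_cmod_le (psum_cvg ha z1)); apply: nearW => N.
apply: le_trans (hB N); apply: (le_trans (cmod_sum _ _)).
by apply: ler_sum => n _; rewrite cmodM cmodR cmodX ger0_norm.
Qed.

(** At a nonnegative radius the partial sums are real and nondecreasing, so their limit dominates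
    each of them. *)
Lemma cmod_psum_ge alpha (r : R) N : unit_radius (fun n => (alpha n)%:C) ->
  0 <= r < 1 -> (forall n, 0 <= alpha n) ->
  \sum_(0 <= n < N) alpha n * r ^+ n <= cmod (psum (fun n => (alpha n)%:C) r%:C).
Proof.
move=> ha r01 a0; have /andP[r0 r1] := r01; apply/ler_addgt0Pr => e e0.
have rD := unit_disc_real r01.
have /cvg_cmodP /(_ _ e0) h := psum_cvg ha rD.
have [n [/= hn Nn]] := filter_ex (filterI h (nbhs_infty_ge N)).
set l := psum _ _ in hn *.
have uE : series (fun n => (alpha n)%:C * r%:C ^+ n) n =
    (\sum_(0 <= k < n) alpha k * r ^+ k)%:C.
  rewrite /series /= rmorph_sum; apply: eq_bigr => k _.
  by rewrite rmorphM rmorphXn.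
have {}hn : cmod (series (fun n => (alpha n)%:C * r%:C ^+ n) n - l) <= e := hn.
rewrite uE in hn; set u := _%:C in hn.
have t0 k : 0 <= alpha k * r ^+ k by rewrite mulr_ge0 ?exprn_ge0.
apply: (@le_trans _ _ (cmod u)).
  rewrite cmodR ger0_norm ?sumr_ge0 // [leRHS](@big_cat_nat _ _ _ N) //=.
  by rewrite lerDl sumr_ge0.
have -> : u = l + (u - l) by rewrite addrC subrK.
by apply: (le_trans (cmodD _ _)); rewrite lerD2l.
Qed.

(** At most n+1 summands, each at most 1, make up the n-th coefficient, and n+1 is the n-th
    coefficient of the derived geometric series. *)
Lemma unit_radius_sparse c nu : (forall k, 0 <= c k <= 1) ->
  unit_radius (fun n => (sparse c nu n)%:C).
Proof.
move=> c01 r r01; have /andP[r0 r1] := r01.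
have h1 : unit_radius (fun=> 1 : R[i]).
  move=> s /andP[s0 s1]; exists 1 => n.
  by rewrite /cmod Normc.normc1 mul1r exprn_ile1 // ltW.
have [K hK] := unit_radius_pdiff h1 r01.
exists K => n; apply: le_trans (hK n).
rewrite ler_wpM2r ?exprn_ge0 // /pdiff mulr1 cmod_nat cmodR ger0_norm.
  exact: sparse_le.
by apply: sparse_ge0 => k; case/andP: (c01 k).
Qed.

End NonnegativeSeries.

(** * Fractional derivatives and weighted bounds for sparse series *)

Section Comparison.
Variables (R : realType) (mu : R -> R).
Hypothesis mu_weight : radial_weight mu.
Hypothesis tail_gt0 : forall z, unit_disc z -> 0 < weight_tail mu z.
Local Notation T := (tail_integral mu).

Definition odd_moment n := weight_moment mu (2 * n + 1)%N%:R.
Local Notation m := odd_moment.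

Let T_gt0 r : 0 <= r < 1 -> 0 < T r.
Proof.
move=> r01; have /andP[r0 _] := r01; have := tail_gt0 (unit_disc_real r01).
by rewrite /weight_tail cmodR ger0_norm.
Qed.

Let T_le := tail_integral_le mu_weight.
Let T_small := tail_integral_small mu_weight.

Let m_ge n r : 0 <= r < 1 -> r ^+ (2 * n + 1) * T r <= m n.
Proof. exact: weight_moment_ge. Qed.

(** Since r^n / m_n <= K q^n with q < 1, bounded terms at radius q give bounded quotients at radius
    r; hence the fractional derivative converges in the whole disc. *)
Lemma unit_radius_div_moment (a : nat -> R[i]) : unit_radius a ->
  unit_radius (fun n => a n / (m n)%:C).
Proof.
move=> ha r r01; have [K [q [K0 q01 hK]]] := power_over_moment T_gt0 m_ge r01.
have [K' hK'] := ha q q01.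
exists (K * K') => n; have m0 := moment_gt0 T_gt0 m_ge n.
rewrite cmodM -fmorphV cmodR gtr0_norm ?invr_gt0 // -mulrA.
apply: (@le_trans _ _ (cmod (a n) * (K * q ^+ n))).
  by rewrite ler_wpM2l ?cmod_ge0 // mulrC.
by rewrite mulrCA ler_wpM2l.
Qed.

Lemma frac_derivative_psum (a : nat -> R[i]) : unit_radius a ->
  frac_derivative mu (psum a) = psum (fun n => a n / (m n)%:C).
Proof.
move=> ha; apply/funext => z; rewrite /frac_derivative /psum.
by under eq_fun do rewrite taylor_coef_psum //.
Qed.

Section Sparse.
Variables (c : nat -> R) (nu : nat -> nat).
Hypothesis c01 : forall k, 0 <= c k <= 1.
Hypothesis nu_ge : forall k, (k <= nu k)%N.

Definition sparse_series := psum (fun n => (sparse c nu n)%:C).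

Let c_ge0 k : 0 <= c k. Proof. by case/andP: (c01 k). Qed.

Let ur := unit_radius_sparse nu c01.

Let urm : unit_radius (fun n => (sparse c nu n / m n)%:C).
Proof.
rewrite (_ : (fun _ => _) = fun n => (sparse c nu n)%:C / (m n)%:C).
  exact: unit_radius_div_moment.
by apply/funext => n; rewrite rmorphM fmorphV.
Qed.

Let mV_ge0 n : 0 <= (m n)^-1.
Proof. by rewrite invr_ge0 ltW // (moment_gt0 T_gt0 m_ge). Qed.

Let fracE : frac_derivative mu sparse_series =
  psum (fun n => (sparse c nu n / m n)%:C).
Proof.
rewrite frac_derivative_psum //; congr psum; apply/funext => n.
by rewrite rmorphM fmorphV.
Qed.

Lemma sparse_series_analytic : analytic_in_disc sparse_series.
Proof. exact: psum_analytic. Qed.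

Lemma cmod_sparse_series_le z B : unit_disc z ->
  (forall N, \sum_(0 <= k < N) c k * cmod z ^+ nu k <= B) ->
  cmod (sparse_series z) <= B.
Proof.
move=> z1 hB; apply: cmod_psum_le => // [n|N]; first exact: sparse_ge0.
have x0 n : 0 <= cmod z ^+ n by rewrite exprn_ge0 ?cmod_ge0.
exact: le_trans (sum_sparse_le N nu_ge c_ge0 x0) (hB N).
Qed.

Lemma cmod_sparse_series_ge r K : 0 <= r < 1 ->
  \sum_(0 <= k < K) c k * r ^+ nu k <= cmod (sparse_series r%:C).
Proof.
move=> r01; have /andP[r0 r1] := r01.
have xr n : 0 <= r ^+ n by rewrite exprn_ge0.
have [N hN] := sum_sparse_ge K nu_ge c_ge0 xr.
apply: (le_trans hN); apply: cmod_psum_ge => // n.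
exact: sparse_ge0.
Qed.

Lemma bloch_quotient_le z B : unit_disc z ->
  (forall N, \sum_(0 <= k < N) c k * peak T m (nu k) (cmod z) <= B) ->
  weight_tail mu z * cmod (frac_derivative mu sparse_series z) <= B.
Proof.
move=> z1 hB; have z01 : 0 <= cmod z < 1 by rewrite cmod_ge0.
have Tz := T_gt0 z01.
rewrite -[weight_tail mu z]/(T (cmod z)) fracE mulrC -ler_pdivlMr //.
apply: cmod_psum_le => // [n|N]; first by rewrite mulr_ge0 // sparse_ge0.
rewrite ler_pdivlMr //; apply: le_trans (hB N).
apply: le_trans (sum_sparse_le N nu_ge c_ge0 (fun n => peak_ge0 T_gt0 m_ge n z01)).
rewrite mulr_suml; apply: ler_sum => n _; rewrite /peak.
by rewrite le_eqVlt; apply/orP; left; apply/eqP; ring.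
Qed.

(** At a nonnegative real point all terms are nonnegative, so a single one bounds the sum from
    below. *)
Lemma bloch_quotient_ge r k : 0 <= r < 1 ->
  c k * peak T m (nu k) r <=
  weight_tail mu r%:C * cmod (frac_derivative mu sparse_series r%:C).
Proof.
move=> r01; have /andP[r0 r1] := r01; have Tr := T_gt0 r01.
rewrite /weight_tail cmodR ger0_norm // -/(T r) fracE.
have [N hN] := sum_sparse_ge k.+1 nu_ge c_ge0 (fun n => peak_ge0 T_gt0 m_ge n r01).
apply: (@le_trans _ _ (\sum_(0 <= n < N) sparse c nu n * peak T m n r)).
  apply: le_trans hN; rewrite big_nat_recr //= lerDr sumr_ge0 // => i _.
  by rewrite mulr_ge0 // peak_ge0.
rewrite mulrC -ler_pdivrMr //.
apply: le_trans (cmod_psum_ge N urm r01 _); last first.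
  by move=> n; rewrite mulr_ge0 // sparse_ge0.
rewrite ler_pdivrMr // mulr_suml; apply: ler_sum => n _; rewrite /peak.
by rewrite le_eqVlt; apply/orP; left; apply/eqP; ring.
Qed.

End Sparse.

(** * The two failures of inclusion *)

Lemma bloch_space_not_sub_hardy C :
  (forall n r, 0 <= r < 1 -> peak T m n r <= C) ->
  exists2 f, bloch_space mu f & ~ hardy_infty R f.
Proof.
move=> /(gliding_hump T_gt0 T_le T_small m_ge)[nu [nu_ge hnu]].
have c01 (k : nat) : 0 <= (1 : R) <= 1 by rewrite ler01 lexx.
exists (sparse_series (fun=> 1) nu).
  split; first exact: sparse_series_analytic.
  apply: (@le_lt_trans _ _ (C + 2)%:E); last exact: ltry.
  apply: ub_ereal_sup => _ [z z1 <-]; rewrite lee_fin.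
  apply: bloch_quotient_le => // N.
  by under eq_bigr do rewrite mul1r; rewrite hnu // cmod_ge0.
move=> [_ [M hM]].
(* K terms of size at least 1/2 will exceed the supposed bound [M]. *)
pose K := (Num.bound (2 * `|M|)).
have hK : 2 * `|M| < K%:R by apply: archi_boundP; rewrite mulr_ge0.
(* The sum dominates each [nu k] with k < K, so all these monomials are at least 1/2 at the same
   r. *)
have [r [r01 hr]] := @near1_power R (\sum_(0 <= k < K) nu k).
have /andP[r0 r1] := r01.
have rD := unit_disc_real r01.
have := le_trans (cmod_sparse_series_ge c01 nu_ge K r01) (hM _ rD).
apply/negP; rewrite -ltNge.
have MK : M < K%:R * 2^-1 
  by rewrite ltr_pdivlMr // mulrC (le_lt_trans _ hK) // ler_pM2l // ler_norm.
apply: (lt_le_trans MK).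
rewrite mulr_natl -[K in leLHS]subn0 -sumr_const_nat.
apply: ler_sum_nat => k /andP[_ kK]; rewrite mul1r; apply: (le_trans hr).
apply: ler_wiXn2l => //; first exact: ltW.
by rewrite big_mkord (bigD1 (Ordinal kK)) //= leq_addr.
Qed.

Lemma hardy_not_sub_bloch_space :
  ~ (exists C, forall n r, 0 <= r < 1 -> peak T m n r <= C) ->
  exists2 f, hardy_infty R f & ~ bloch_space mu f.
Proof.
move=> /(unbounded_peaks T_gt0 T_le m_ge)[nu [rho hnu]].
have nu_ge k : (k <= nu k)%N by case: (hnu k).
have c01 k : 0 <= (2^-1 : R) ^+ k <= 1.
  by rewrite exprn_ge0 // exprn_ile1 // invf_le1 // ler1n.
exists (sparse_series (fun k => 2^-1 ^+ k) nu).
  split; first exact: sparse_series_analytic.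
  exists 2 => z z1; apply: cmod_sparse_series_le => // N.
  apply: le_trans (sum_half R N); apply: ler_sum => k _.
  by rewrite ler_piMr // exprn_ile1 ?cmod_ge0 // ltW.
move=> [_]; set s := bloch_norm _ _ => soo.
have hs k : ((2 ^+ k : R)%R%:E <= s)%E.
  have [_ rho01 hk] := hnu k.
  apply: (@le_trans _ _ (weight_tail mu (rho k)%:C *
     cmod (frac_derivative mu (sparse_series (fun k => 2^-1 ^+ k) nu) (rho k)%:C))%:E).
    rewrite lee_fin; apply: le_trans (bloch_quotient_ge c01 nu_ge k rho01).
    apply: le_trans (ler_wpM2l _ hk); last by rewrite exprn_ge0.
    by rewrite -exprMn (_ : 2^-1 * 4 = 2 :> R) //; field.
  apply: ereal_sup_ubound; exists (rho k)%:C => //.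
  exact: unit_disc_real.
have sfin : s \is a fin_num.
  by rewrite fin_real // soo andbT (lt_le_trans _ (hs 0%N)) // ltNyr.
(* Finiteness of the norm is contradicted at this k, since |s| < k < 2^k <= s. *)
pose k := Num.bound `|fine s|.
have hk : `|fine s| < k%:R := archi_boundP (normr_ge0 _).
have := hs k; rewrite -(fineK sfin) lee_fin; apply/negP; rewrite -ltNge.
apply: (le_lt_trans (ler_norm _)); apply: (lt_le_trans hk).
by rewrite -natrX ler_nat ltnW // ltn_expl.
Qed.

End Comparison.

Theorem proposition1 (R : realType) (mu : R -> R)
  (mu_weight : radial_weight mu)
  (tail_gt0 : forall z, unit_disc z -> 0 < weight_tail mu z) :
  hardy_infty R <> bloch_space mu.
Proof.
move=> HB.
(* Excluded middle on uniform boundedness of the peaks; each case yields a function lying in exactly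
   one of the two spaces. *)
have [[C hC]|nb] := pselect (exists C, forall n r, 0 <= r < 1 ->
    peak (tail_integral mu) (odd_moment mu) n r <= C).
  have [f] := bloch_space_not_sub_hardy mu_weight tail_gt0 hC.
  by rewrite HB.
have [f] := hardy_not_sub_bloch_space mu_weight tail_gt0 nb.
by rewrite HB.
Qed.
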